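(* Let $(A,H,D,J)$, where $D=\sum_{\ell=1}^N D_\ell$, be a spectral triple with multitwisted real structure with twists $\nu_\ell$, satisfying the multitwisted zero order condition and the multitwisted first-order condition. Let $\omega=\sum_i a_i[D,b_i]$ (with $a_i,b_i\in A$) be a selfadjoint one-form and put $\omega_\ell=\sum_i a_i[D_\ell,b_i]$ and $(D_\omega)_\ell=D_\ell+\omega_\ell$. If the sum $$\sum_{\ell=1}^N\nu_\ell J\,(\omega_\ell)\,J^{-1}\nu_\ell$$ is bounded, then taking $$(D_\omega)'_\ell=D_\ell+\omega_\ell+\epsilon'\,\nu_\ell J\,(\omega_\ell)\,J^{-1}\nu_\ell$$ and $$D'_\omega=\sum_{\ell=1}^N(D_\omega)'_\ell,$$ $(A,H,D'_\omega,J)$ is a spectral triple with a multitwisted real structure, with the same twists $\nu_\ell$, satisfying the multitwisted zero order condition, the multitwisted first-order condition and the multitwisted $\epsilon'$ condition (with respect to the decomposition $D'_\omega=\sum_{\ell=1}^N(D_\omega)'_\ell$). Moreover, for each $a\in A$ (and each $\ell$), $$[(D_\omega)'_\ell,a]=[(D_\omega)_\ell,a].$$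
   Context: A spectral triple $(A,H,D)$ consists of a $*$-algebra $A$ identified with a subalgebra of $B(H)$, $H$ a Hilbert space, and a densely defined selfadjoint operator $D$ on $H$ with compact resolvent such that $[D,a]$ is bounded for each $a\in A$. A real spectral triple $(A,H,D,J)$ is a spectral triple together with an antilinear isometry $J$ on $H$ with $J^2=\pm1$ and $[a,JbJ^{-1}]=0$ for all $a,b\in A$. It is a real even spectral triple $(A,H,D,J,\gamma)$ if in addition there is a grading $\gamma$ of $H$ with $\gamma^2=1$, $D\gamma=-\gamma D$, $[\gamma,a]=0$ for all $a\in A$ and $\gamma J=\pm J\gamma$. A real spectral triple $(A,H,D,J)$ is a spectral triple with multitwisted real structure if there are $N$ densely defined operators $D_\ell$, $\ell=1,\dots,N$, whose domains contain the domain of $D$, with $\sum_{\ell=1}^N D_\ell=D$, and for every $\ell$ there exists an operator (twist) $\nu_\ell\in B(H)$ with bounded inverse such that for all $a,b\in A$ the multitwisted zero order condition $$[a,J\bar\nu_\ell(b)J^{-1}]=0=[a,J\bar\nu_\ell^{-1}(b)J^{-1}]$$ holds, where $\bar\nu_\ell=\mathrm{Ad}_{\nu_\ell}\in\mathrm{Aut}(B(H))$, i.e. $\bar\nu_\ell(x)=\nu_\ell x\nu_\ell^{-1}$. If the spectral triple is even one additionally assumes $\gamma\nu_\ell^2=\nu_\ell^2\gamma$ for all $\ell$. Individual $D_\ell$ are not required to be selfadjoint with compact resolvent, nor are the individual $[D_\ell,a]$ required to be bounded. The multitwisted first-order condition is: $[D_\ell,a]\,J\bar\nu_\ell(b)J^{-1}=J\bar\nu_\ell^{-1}(b)J^{-1}\,[D_\ell,a]$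 for all $a,b\in A$ and all $\ell$. The multitwisted $\epsilon'$ condition is: $D_\ell J\nu_\ell=\epsilon'\nu_\ell JD_\ell$ for all $\ell$, where $\epsilon'=\pm1$. For $(A,H,D'_\omega,J)$ these conditions are taken with $(D_\omega)'_\ell$ in place of $D_\ell$.
   Formalization: Formal version adds: the D_ℓ satisfy the multitwisted ε′ condition; ν_ℓJν_ℓ=J; the bounded sum Σν_ℓJω_ℓJ⁻¹ν_ℓ is symmetric. Each omission admits counterexamples. Also A is taken to preserve each dom D_ℓ so that [D_ℓ,a] is defined there. *)

(* Defs.v *)
From HB Require Import structures.
From mathcomp Require Import all_boot all_order all_algebra.
From mathcomp Require Import complex.
From mathcomp Require Import all_classical all_reals topology normedtype.

Set Implicit Arguments.
Unset Strict Implicit.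
Unset Printing Implicit Defensive.

Import Order.TTheory GRing.Theory Num.Theory.
Import numFieldNormedType.Exports.

Local Open Scope classical_set_scope.
Local Open Scope ring_scope.

(* A complex Hilbert space is a complete normed space [H] over [R[i]] with a
   form [ip : {dot H for Num.conj}] (linear in its first argument) satisfying
   [hilbert_norm ip]. *)
Definition hilbert_norm (R : realType) (H : completeNormedModType R[i])
    (ip : {dot H for (@Num.conj R[i])}) : Prop :=
  forall x : H, `|x| ^+ 2 = ip x x.

(* Unbounded operators are partial maps: only the values on [udom T] are
   meaningful, and algebraic expressions carry their natural domains. *)
Record unbounded (T : Type) := Unbounded { udom : set T; uapp :> T -> T }.

Section PartialMaps.
Context {R : realType} {H : completeNormedModType R[i]}.
Implicit Types (S T : unbounded H) (f : H -> H).

Definition ufull f : unbounded H := Unbounded setT f.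

Definition uadd S T : unbounded H :=
  Unbounded (udom S `&` udom T) (fun x => S x + T x).

Definition usub S T : unbounded H :=
  Unbounded (udom S `&` udom T) (fun x => S x - T x).

Definition uscale (c : R[i]) T : unbounded H := Unbounded (udom T) (fun x => c *: T x).

Definition ucomp S T : unbounded H :=
  Unbounded [set x | udom T x /\ udom S (T x)] (fun x => S (T x)).

Definition usum n (F : 'I_n -> unbounded H) : unbounded H :=
  Unbounded [set x | forall i, udom (F i) x] (fun x => \sum_(i < n) F i x).

Definition urestrict (E : set H) T : unbounded H := Unbounded (E `&` udom T) T.

Definition uextends S T : Prop :=
  udom S `<=` udom T /\ forall x, udom S x -> S x = T x.

Definition ueq S T : Prop :=
  udom S = udom T /\ forall x, udom S x -> S x = T x.

Definition ucomm T f : unbounded H := usub (ucomp T (ufull f)) (ucomp (ufull f) T).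

Definition ubounded T : Prop :=
  exists M : R[i], forall x, udom T x -> `|T x| <= M * `|x|.

Definition linear_operator T : Prop :=
  udom T 0 /\
  forall (c : R[i]) x y, udom T x -> udom T y ->
    udom T (c *: x + y) /\ T (c *: x + y) = c *: T x + T y.

Definition densely_defined T : Prop := dense (udom T).

Definition bounded_operator f : Prop := linear f /\ ubounded (ufull f).

Definition compact_operator f : Prop :=
  linear f /\ precompact (f @` [set x | `|x| <= 1]).

(* [G] is the inverse of the bijection [T - z : udom T -> H]. *)
Definition is_resolvent T (z : R[i]) (G : H -> H) : Prop :=
  (forall y, udom T (G y) /\ T (G y) - z *: G y = y) /\
  (forall x, udom T x -> G (T x - z *: x) = x).

Definition compact_resolvent T : Prop :=
  exists (z : R[i]) (G : H -> H), is_resolvent T z G /\ compact_operator G.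

Definition stabilizes_domain (A : set (H -> H)) T : Prop :=
  forall a, A a -> forall x, udom T x -> udom T (a x).

End PartialMaps.

Section SpectralTriples.
Context {R : realType} {H : completeNormedModType R[i]}.
Variable ip : {dot H for (@Num.conj R[i])}.
Implicit Types (A : set (H -> H)) (T D : unbounded H) (J Jinv : H -> H).

(* [y] is in the domain of the adjoint of [T], with value [z]. *)
Definition adjoint_graph T (y z : H) : Prop :=
  forall x, udom T x -> ip (T x) y = ip x z.

Definition selfadjoint T : Prop :=
  densely_defined T /\
  forall y z, adjoint_graph T y z <-> (udom T y /\ T y = z).

Definition symmetric_operator T : Prop :=
  forall x y, udom T x -> udom T y -> ip (T x) y = ip x (T y).

(* A densely defined bounded [T] is identified with its extension to [H]. *)
Definition bounded_selfadjoint T : Prop :=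
  exists B : H -> H,
    [/\ bounded_operator B, selfadjoint (ufull B) & uextends T (ufull B)].

(* *-subalgebra of B(H), not necessarily unital or closed *)
Record star_algebra A : Prop := StarAlgebra {
  star_bounded : forall a, A a -> bounded_operator a;
  star_zero : A (fun=> 0);
  star_lin : forall (c : R[i]) a b, A a -> A b -> A (fun x => c *: a x + b x);
  star_mul : forall a b, A a -> A b -> A (a \o b);
  star_adj : forall a, A a ->
    exists2 a', A a' & forall x y, ip (a x) y = ip x (a' y) }.

Record spectral_triple A D : Prop := SpectralTriple {
  st_algebra : star_algebra A;
  st_linear : linear_operator D;
  st_selfadjoint : selfadjoint D;
  st_compact : compact_resolvent D;
  st_domain : stabilizes_domain A D;
  st_bounded : forall a, A a -> ubounded (ucomm D a) }.

Definition commuting (f g : H -> H) : Prop := f \o g = g \o f.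

Definition conjugate_by (f finv b : H -> H) : H -> H := f \o b \o finv.

Definition antilinear_isometry J : Prop :=
  (forall (c : R[i]) x y, J (c *: x + y) = Num.conj c *: J x + J y) /\
  (forall x, `|J x| = `|x|).

Record real_spectral_triple A D J Jinv : Prop := RealSpectralTriple {
  rst_triple : spectral_triple A D;
  rst_isometry : antilinear_isometry J;
  rst_inv : cancel J Jinv /\ cancel Jinv J;
  rst_square : (forall x, J (J x) = x) \/ (forall x, J (J x) = - x);
  rst_commute : forall a b, A a -> A b -> commuting a (conjugate_by J Jinv b) }.

Section Multitwisted.
Variables (A : set (H -> H)) (J Jinv : H -> H) (N : nat).
Variables (nu nuinv : 'I_N -> H -> H).
Implicit Types Dl : 'I_N -> unbounded H.

Definition zero_order : Prop := forall l a b, A a -> A b ->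
  commuting a (conjugate_by J Jinv (conjugate_by (nu l) (nuinv l) b)) /\
  commuting a (conjugate_by J Jinv (conjugate_by (nuinv l) (nu l) b)).

(* [mt_domain] is what makes each [D_l, a] an operator on the whole of
   [udom (Dl l)]; these commutators need not be bounded. *)
Record multitwisted_real_structure D Dl : Prop := MultitwistedRealStructure {
  mt_triple : real_spectral_triple A D J Jinv;
  mt_linear : forall l, linear_operator (Dl l);
  mt_dense : forall l, densely_defined (Dl l);
  mt_contains : forall l, udom D `<=` udom (Dl l);
  mt_domain : forall l, stabilizes_domain A (Dl l);
  mt_sum : ueq D (urestrict (udom D) (usum Dl));
  mt_twist : forall l, bounded_operator (nu l);
  mt_twist_inv : forall l,
    [/\ bounded_operator (nuinv l), cancel (nu l) (nuinv l)
      & cancel (nuinv l) (nu l)];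
  mt_zero_order : zero_order }.

(* As usual for S T = T S' with S, S' bounded and T unbounded, the equality
   means that T S' extends S T. *)
Definition first_order Dl : Prop := forall l a b, A a -> A b ->
  uextends
    (ucomp (ufull (conjugate_by J Jinv (conjugate_by (nuinv l) (nu l) b)))
           (ucomm (Dl l) a))
    (ucomp (ucomm (Dl l) a)
           (ufull (conjugate_by J Jinv (conjugate_by (nu l) (nuinv l) b)))).

Definition epsilon'_condition (e : R[i]) Dl : Prop := forall l,
  ueq (ucomp (Dl l) (ucomp (ufull J) (ufull (nu l))))
      (uscale e (ucomp (ufull (nu l)) (ucomp (ufull J) (Dl l)))).

Definition regular_twists : Prop := forall l x, nu l (J (nu l x)) = J x.

End Multitwisted.

Section Fluctuations.
Variables (J Jinv : H -> H) (N : nat) (nu : 'I_N -> H -> H).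
Variables (m : nat) (a b : 'I_m -> H -> H).
Implicit Types (Dl : 'I_N -> unbounded H) (l : 'I_N).

Definition one_form T : unbounded H :=
  usum (fun i => ucomp (ufull (a i)) (ucomm T (b i))).

Definition twisted_conjugate Dl l : unbounded H :=
  ucomp (ufull (nu l)) (ucomp (ufull J)
    (ucomp (one_form (Dl l)) (ucomp (ufull Jinv) (ufull (nu l))))).

Definition fluctuation Dl l : unbounded H := uadd (Dl l) (one_form (Dl l)).

Definition real_fluctuation (e : R[i]) Dl l : unbounded H :=
  uadd (fluctuation Dl l) (uscale e (twisted_conjugate Dl l)).

(* Like [D] itself, the fluctuated operator is the sum of its parts on the
   domain of [D]: it is a bounded perturbation of [D]. *)
Definition fluctuated_D (e : R[i]) D Dl : unbounded H :=
  urestrict (udom D) (usum (real_fluctuation e Dl)).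

End Fluctuations.

End SpectralTriples.

(* Main.v *)
Require Import Defs.
From HB Require Import structures.
From mathcomp Require Import all_boot all_order all_algebra.
From mathcomp Require Import complex ring.
From mathcomp Require Import all_classical all_reals topology normedtype.
Import Order.TTheory GRing.Theory Num.Theory.
Import numFieldNormedType.Exports.
Local Open Scope classical_set_scope.
Local Open Scope ring_scope.

(** Write [T] for one of the parts [D_l], [nu] for its twist, [om] for
    [sum_i a_i [T, b_i]] and [W = nu J om J^-1 nu], so that the fluctuated part
    is [T' = T + om + e W].  The statement splits into an algebraic half, about
    one part at a time, and an analytic half, about the sum.

    Algebra.  Put [hat c = J nu c nu^-1 J^-1] and [chk c = J nu^-1 c nu J^-1].
    The zero order condition says that both commute with the algebra, and the
    first order condition that [chk c [T, d] = [T, d] (hat c)]; together they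
    give [chk c om = om (hat c)] ([one_form_first_order]).  Since [J^-1 = J] up
    to a sign, [J^-1 nu c = hat c J^-1 nu] and [nu J (chk c) = c nu J], so [W]
    commutes with the algebra ([twisted_conjugate_commutes]).  Hence
    [[T', c] = [T, c] + [om, c]], and both summands satisfy the first order
    condition.  For the epsilon condition, regularity [nu J nu = J] gives
    [W J nu = nu J om] and [nu J W = om J nu]: the two added terms of [T'] are
    exchanged ([real_fluctuation_epsilon]).  Everything takes place on the
    domain of [T], which [J nu], by the epsilon condition, and the algebra
    preserve.

    Analysis.  On the domain of [D] the fluctuated operator is [D + V] with [V]
    bounded and symmetric ([fluctuated_D_perturbation]), so the claim is that
    such a perturbation of a spectral triple is a spectral triple
    ([spectral_triple_perturbation]).
    - Selfadjointness: for each [y] there is a [v] with [<V x, y> = <x, v>] on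
      the domain, namely the limit of [V x_n] for [x_n] tending to [y]; thus [y]
      is in the domain of the adjoint of [D + V] iff it is in that of [D].
    - Compact resolvent: if [G] inverts [D - z] and [|V||G| <= 1/2], solving
      [u + V G u = y] by a contraction inverts [D + V - z] by the composite of
      [G] with the bounded map sending [y] to [u], which is again compact.  As
      [D] is symmetric, its resolvent at [w] has norm at most [1 / |Im w|], so
      it suffices to find resolvent points of [D] far from the real axis.  The
      same contraction argument, applied to scalar perturbations, moves from any
      resolvent point away from the axis by steps of a fixed length
      ([compact_resolvent_far]). *)

Set Implicit Arguments.
Unset Strict Implicit.
Unset Printing Implicit Defensive.

(** * Geometric convergence *)

Section Completeness.
Context {R : realType} {H : completeNormedModType R[i]}.

Lemma complex_archimedean (x : R[i]) : 0 <= x -> exists n, x < n%:R.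
Proof.
move=> x0; exists (Num.truncn (complex.Re x)).+1.
rewrite -(RRe_real (ger0_real x0)) -[_%:R](rmorph_nat (real_complex R)) ltcR.
exact: truncnS_gt.
Qed.

Lemma half_pow_lt (c e : R[i]) :
  0 <= c -> 0 < e -> exists n, c * 2^-1 ^+ n < e.
Proof.
move=> c0 e0; have [n cn] := complex_archimedean (divr_ge0 c0 (ltW e0)).
exists n; rewrite exprVn ltr_pdivrMr ?exprn_gt0 // mulrC -ltr_pdivrMr //.
by rewrite (lt_le_trans cn) // -natrX ler_nat ltnW // ltn_expl.
Qed.

Lemma eq0_of_le_small (V : normedZmodType R[i]) (x : V) (c : R[i]) :
  0 <= c -> (forall e, 0 < e -> `|x| <= c * e) -> x = 0.
Proof.
move=> c0 hx; apply/eqP/contraT; rewrite -normr_gt0 => x0.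
have c1 : 0 < 2 * (c + 1) by rewrite mulr_gt0 // ltr_wpDl.
have := hx _ (divr_gt0 x0 c1).
rewrite mulrA ler_pdivlMr // mulrC ler_pM2r // => h.
have : 2 * (c + 1) <= 2 * c + 0.
  by rewrite addr0 (le_trans h) // ler_peMl // ler1n.
by rewrite mulrDr lerD2l mulr1 lern0.
Qed.

Lemma half_steps_dist (y : nat -> H) (c : R[i]) :
  (forall n, `|y n.+1 - y n| <= c * 2^-1 ^+ n) ->
  forall n k, `|y (n + k)%N - y n| <= 2 * c * 2^-1 ^+ n.
Proof.
move=> hy n k.
have c0 : 0 <= c by have := le_trans (normr_ge0 _) (hy 0%N); rewrite mulr1.
(* the exact partial sum of the geometric series makes the induction go through *)
have bound : `|y (n + k)%N - y n| <= 2 * c * (2^-1 ^+ n - 2^-1 ^+ (n + k)).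
  elim: k => [|k IH]; first by rewrite addn0 !subrr normr0 mulr0.
  rewrite addnS -(subrKA (y (n + k)%N)) (le_trans (ler_normD _ _)) //.
  have /le_trans -> // := lerD (hy (n + k)%N) IH.
  rewrite exprS -subr_ge0.
  rewrite [X in 0 <= X](_ : _ = 0) //.
  have : (2 : R[i]) != 0 by rewrite pnatr_eq0.
  by move=> *; field.
apply: le_trans bound _; apply: ler_wpM2l; first by rewrite mulr_ge0.
by rewrite lerBlDr lerDl exprn_ge0 // invr_ge0.
Qed.

Lemma half_steps_cvg (y : nat -> H) (c : R[i]) :
  (forall n, `|y n.+1 - y n| <= c * 2^-1 ^+ n) -> cvgn y.
Proof.
move=> hy; have dist := half_steps_dist hy.
have c0 : 0 <= c by have := le_trans (normr_ge0 _) (hy 0%N); rewrite mulr1.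
apply/cauchy_cvgP/cauchy_exP => e e0.
have [n hn] := half_pow_lt (mulr_ge0 (ler0n _ 2) c0) e0.
exists (y n); exists n => // k /= nk; rewrite -ball_normE /= distrC.
by rewrite -(subnKC nk) (le_lt_trans (dist n _)).
Qed.

(** Banach's fixed point theorem over the complex scalars; the ratio [1/2] is
    all that the resolvent estimates below use. *)
Lemma half_lipschitz_fixpoint (f : H -> H) :
  (forall u v, `|f u - f v| <= 2^-1 * `|u - v|) -> exists p, f p = p.
Proof.
move=> hf; pose y n := iter n f 0.
have hy n : `|y n.+1 - y n| <= `|y 1%N - y 0%N| * 2^-1 ^+ n.
  elim: n => [|n IH]; first by rewrite mulr1.
  by rewrite (le_trans (hf _ _)) // exprS mulrCA ler_pM2l // invr_gt0.
have [p yp] : exists p : H, y @ \oo --> p.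
  by exists (lim (y @ \oo)); exact: half_steps_cvg hy.
exists p; apply/subr0_eq/(@eq0_of_le_small _ _ 2) => // e e0.
move/cvgrPdist_lt: yp => /(_ _ e0) [n _ hn].
rewrite -(subrKA (y n.+1)) (le_trans (ler_normD _ _)) //.
rewrite mulr_natl mulr2n lerD //.
  rewrite (le_trans (hf _ _)) // (@le_trans _ _ (2^-1 * e)) //.
    by rewrite ler_pM2l ?invr_gt0 // ltW // hn /=.
  by rewrite ger_pMl // invf_le1 // ler1n.
by rewrite distrC ltW // hn //=.
Qed.

End Completeness.

(** * Linear maps and partially defined linear operators *)

Section LinearMaps.
Context {R : realType} {H : completeNormedModType R[i]}.
Variables (f : H -> H) (linf : linear f).

Lemma linfunD x y : f (x + y) = f x + f y.
Proof. by rewrite -[x]scale1r linf !scale1r. Qed.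

Lemma linfun0 : f 0 = 0.
Proof. by have := linfunD 0 0; rewrite addr0 -{1}[f 0]addr0 => /addrI. Qed.

Lemma linfunZ (c : R[i]) x : f (c *: x) = c *: f x.
Proof. by rewrite -[c *: x]addr0 linf linfun0 addr0. Qed.

Lemma linfunB x y : f (x - y) = f x - f y.
Proof. by rewrite -scaleN1r linfunD linfunZ scaleN1r. Qed.

Lemma linfun_sum (I : Type) (r : seq I) (F : I -> H) :
  f (\sum_(i <- r) F i) = \sum_(i <- r) f (F i).
Proof. by elim/big_rec2: _ => [|i y1 y2 _ <-]; rewrite ?linfun0 ?linfunD. Qed.

End LinearMaps.

Section LinearOperators.
Context {R : realType} {H : completeNormedModType R[i]}.
Variables (T : unbounded H) (linT : linear_operator T).

Lemma udom0 : udom T 0. Proof. by case: linT. Qed.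

Lemma udomD x y : udom T x -> udom T y -> udom T (x + y).
Proof. by move=> dx dy; have [+ _] := linT.2 1 x y dx dy; rewrite scale1r. Qed.

Lemma uappD x y : udom T x -> udom T y -> T (x + y) = T x + T y.
Proof. by move=> dx dy; have [_] := linT.2 1 x y dx dy; rewrite !scale1r. Qed.

Lemma uapp0 : T 0 = 0.
Proof. by have := uappD udom0 udom0; rewrite addr0 -{1}[T 0]addr0 => /addrI. Qed.

Lemma udomZ (c : R[i]) x : udom T x -> udom T (c *: x).
Proof. by move=> dx; have [+ _] := linT.2 c x 0 dx udom0; rewrite addr0. Qed.

Lemma uappZ (c : R[i]) x : udom T x -> T (c *: x) = c *: T x.
Proof.
by move=> dx; have [_] := linT.2 c x 0 dx udom0; rewrite !addr0 uapp0 addr0.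
Qed.

Lemma udomB x y : udom T x -> udom T y -> udom T (x - y).
Proof. by move=> dx dy; rewrite -scaleN1r; apply/udomD => //; exact: udomZ. Qed.

Lemma uappB x y : udom T x -> udom T y -> T (x - y) = T x - T y.
Proof.
move=> dx dy; have dNy := udomZ (-1) dy.
by rewrite -scaleN1r uappD // uappZ // scaleN1r.
Qed.

Lemma resolvent_linear z G : is_resolvent T z G -> linear G.
Proof.
move=> [GR GL] c x y.
have [dx ex] := GR x; have [dy ey] := GR y.
have [dxy exy] := linT.2 c _ _ dx dy.
rewrite -[RHS]GL // exy; congr (G _).
by rewrite -{1}ex -{1}ey scalerBr scalerDr !scalerA [z * c]mulrC opprD addrACA.
Qed.

End LinearOperators.

(** In a trivial space a bound may be any scalar; elsewhere it is already
    nonnegative. *)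
Lemma ubounded_ge0 (R : realType) (H : completeNormedModType R[i])
    (T : unbounded H) : ubounded T ->
  exists2 M : R[i], 0 <= M & forall x, udom T x -> `|T x| <= M * `|x|.
Proof.
move=> [M hM]; exists `|M| => // x dx.
have h := hM x dx; have p := le_trans (normr_ge0 _) h.
by rewrite -[`|x|]normr_id -normrM (ger0_norm p).
Qed.

Lemma ucomm_domain (R : realType) (H : completeNormedModType R[i])
    (S T : unbounded H) (c : H -> H) :
  udom S = udom T -> udom (ucomm S c) = udom (ucomm T c).
Proof. by move=> eST; rewrite /ucomm /= eST. Qed.

(** * Compact operators *)

Section CompactOperators.
Context {R : realType} {H : completeNormedModType R[i]}.

Lemma compact_operator_bounded (G : H -> H) : compact_operator G ->
  exists2 K : R[i], 0 <= K & forall y, `|G y| <= K * `|y|.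
Proof.
move=> [linG [B GB [cB _]]].
(* a compact set has bounded image under the real-valued norm *)
pose nrm (x : H) : R := complex.Re `|x|.
have nrmE x : `|x| = (nrm x)%:C%C by rewrite RRe_real // normr_real.
have cnrm : continuous nrm.
  move=> x; apply/cvgrPdist_lt => e e0.
  have eC : 0 < (e%:C%C : R[i]) by rewrite ltcR.
  near=> y; rewrite -ltcR.
  have -> : `|nrm x - nrm y|%:C%C = `| `|x| - `|y| |.
    by rewrite !nrmE -rmorphB normc_def /= expr0n addr0 sqrtr_sqr.
  rewrite (le_lt_trans (ler_dist_dist _ _)) //; near: y.
have [M [_ hM]] :=
  compact_bounded (continuous_compact (continuous_subspaceT cnrm) cB).
pose K := Num.max 0 (M + 1).
have K0 : 0 <= K by rewrite /K le_max lexx.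
have hK y : `|y| <= 1 -> `|G y| <= K%:C%C.
  move=> y1; rewrite nrmE lecR.
  have BG : B (G y) by apply: GB; exists y.
  have MK : M < M + 1 by rewrite ltrDl.
  have := hM _ MK (nrm (G y)) (ex_intro2 _ _ _ BG erefl).
  move=> /(le_trans (ler_norm _)) /le_trans; apply.
  by rewrite /K le_max lexx orbT.
exists K%:C%C => [|y]; first by rewrite ler0c.
have [->|y0] := eqVneq y 0; first by rewrite (linfun0 linG) !normr0 mulr0.
have ny : 0 < `|y| by rewrite normr_gt0.
rewrite -ler_pdivrMr // mulrC -[`|y|^-1]ger0_norm ?invr_ge0 //.
rewrite -normrZ -(linfunZ linG); apply: hK.
by rewrite normrZ ger0_norm ?invr_ge0 // mulVf // gt_eqF.
Unshelve. all: by end_near. Qed.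

Lemma compact_operator_precomp (G U : H -> H) :
  compact_operator G -> (forall y, `|U y| <= 2 * `|y|) -> linear (G \o U) ->
  compact_operator (G \o U).
Proof.
move=> [linG [B GB [cB _]]] hU linGU; split => //.
have n2 : (2 : R[i]) != 0 by rewrite pnatr_eq0.
have c2 : continuous (fun x : H => (2 : R[i]) *: x) by exact: scaler_continuous.
have c2B := continuous_compact (continuous_subspaceT c2) cB.
exists ((fun x : H => (2 : R[i]) *: x) @` B); last first.
  by split => //; apply: compact_closed => //; exact: norm_hausdorff.
move=> _ [y /= y1 <-]; exists (G (2^-1 *: U y)); last first.
  by rewrite (linfunZ linG) scalerA mulfV // scale1r.
apply: GB; exists (2^-1 *: U y) => //=.
rewrite normrZ ger0_norm ?invr_ge0 // mulrC ler_pdivrMr // mul1r.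
by rewrite (le_trans (hU y)) // ler_piMr.
Qed.

End CompactOperators.

(** * Resolvents of bounded perturbations *)

Section Resolvents.
Context {R : realType} {H : completeNormedModType R[i]}.
Implicit Types T : unbounded H.

(** The map [U] solves [U y + V (G (U y)) = y], a contraction problem as
    [V \o G] has norm at most [1/2]; then [G \o U] inverts [T + V - z].  The
    perturbed operator [T'] and its spectral parameter [z'] are separate from
    [V], so that both [T' = T + V] and a shift of [z] are instances. *)
Lemma resolvent_perturbation T (V : H -> H) (z z' : R[i]) (G : H -> H)
    (c K : R[i]) :
  linear_operator T -> linear_operator (Unbounded (udom T) V) ->
  is_resolvent T z G ->
  (forall x, udom T x -> `|V x| <= c * `|x|) ->
  (forall y, `|G y| <= K * `|y|) -> 0 <= c -> c * K <= 2^-1 ->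
  exists U : H -> H, (forall y, `|U y| <= 2 * `|y|) /\
    forall T', udom T' = udom T ->
      (forall x, udom T x -> T' x - z' *: x = T x - z *: x + V x) ->
      is_resolvent T' z' (G \o U).
Proof.
move=> linT linV rG Vc GK c0 cK; have linG := resolvent_linear linT rG.
have [GR GL] := rG.
have VB x y : udom T x -> udom T y -> V (x - y) = V x - V y.
  by move=> dx dy; exact: (uappB linV).
have VG u v : `|V (G u) - V (G v)| <= 2^-1 * `|u - v|.
  rewrite -(VB _ _ (GR u).1 (GR v).1) -(linfunB linG).
  rewrite (le_trans (Vc _ (GR _).1)) //.
  rewrite (@le_trans _ _ (c * (K * `|u - v|))) ?ler_wpM2l //.
  by rewrite mulrA ler_wpM2r.
have fixU y : exists u, y - V (G u) = u.
  apply: (@half_lipschitz_fixpoint _ _ (fun u => y - V (G u))) => u v.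
  by rewrite opprD addrACA subrr add0r -opprD normrN.
have [U hU] := choice fixU.
exists U; split=> [y|T' dT' hT'].
  have V0 : V 0 = 0 := uapp0 linV.
  have := VG (U y) 0; rewrite (linfun0 linG) V0 !subr0 => h.
  have {}h : `|U y| <= `|y| + 2^-1 * `|U y|.
    by rewrite -{1}(hU y) (le_trans (ler_normB _ _)) // lerD2l.
  move: h; rewrite -lerBlDr -{1}[`|U y|]mul1r -mulrBl.
  have -> : (1 - 2^-1 : R[i]) = 2^-1.
    have : (2 : R[i]) != 0 by rewrite pnatr_eq0.
    by move=> *; field.
  by rewrite mulrC ler_pdivrMr // mulrC.
split=> [y|x dx] /=.
  have [d e] := GR (U y); rewrite dT'; split => //.
  by rewrite hT' // e -{1}(hU y) subrK.
rewrite dT' in dx; rewrite hT' //.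
rewrite -[RHS](GL x dx); congr (G _); set y := _ + V x.
(* [u] solves the fixed point equation defining [U y], which has one solution *)
set u := T x - z *: x.
have Vu : V (G u) = y - u by rewrite GL // addrAC subrr add0r.
have VU : V (G (U y)) = y - U y by apply/esym; rewrite -{1}(hU y) subKr.
have := VG u (U y); rewrite Vu VU.
clearbody u y.
have -> : y - u - (y - U y) = - (u - U y).
  by rewrite opprD addrACA subrr add0r -opprD.
rewrite normrN -subr_ge0 -{2}[`|u - U y|]mul1r -mulrBl => h.
have {}h : `|u - U y| <= 0.
  by rewrite -(@ler_nM2l _ (2^-1 - 1)) ?mulr0 // subr_lt0 invf_lt1 // ltr1n.
by move: h; rewrite normr_le0 subr_eq0 => /eqP.
Qed.

Definition compact_resolvent_at T (z : R[i]) (G : H -> H) : Prop :=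
  is_resolvent T z G /\ compact_operator G.

Lemma compact_resolvent_perturbation T T' (V : H -> H) (z z' : R[i])
    (G : H -> H) (c K : R[i]) :
  linear_operator T -> linear_operator (Unbounded (udom T) V) ->
  compact_resolvent_at T z G ->
  (forall x, udom T x -> `|V x| <= c * `|x|) ->
  (forall y, `|G y| <= K * `|y|) -> 0 <= c -> c * K <= 2^-1 ->
  linear_operator T' -> udom T' = udom T ->
  (forall x, udom T x -> T' x - z' *: x = T x - z *: x + V x) ->
  exists G', compact_resolvent_at T' z' G'.
Proof.
move=> linT linV [rG cG] Vc GK c0 cK linT' dT' hT'.
have [U [Ub hU]] := resolvent_perturbation z' linT linV rG Vc GK c0 cK.
have rU := hU T' dT' hT'; exists (G \o U); split => //.
exact: compact_operator_precomp cG Ub (resolvent_linear linT' rU).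
Qed.

Lemma compact_resolvent_shift T (z d : R[i]) (G : H -> H) (K : R[i]) :
  linear_operator T -> compact_resolvent_at T z G ->
  (forall y, `|G y| <= K * `|y|) -> `|d| * K <= 2^-1 ->
  exists G', compact_resolvent_at T (z + d) G'.
Proof.
move=> linT rG GK dK.
apply: (@compact_resolvent_perturbation T T (fun x => - d *: x) z _ G `|d| K).
all: rewrite //.
- split=> [|c x y dx dy]; first exact: (udom0 linT).
  split=> /=; first by case: (linT.2 c x y dx dy).
  by rewrite scalerDr !scalerA mulrC.
- by move=> x _; rewrite normrZ normrN.
- by move=> x _; rewrite scalerDl opprD addrA scaleNr.
Qed.

End Resolvents.

(** * Symmetric operators *)

Section HilbertSpace.
Context {R : realType} {H : completeNormedModType R[i]}.
Variables (ip : {dot H for (@Num.conj R[i])}) (hH : hilbert_norm ip).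
Implicit Types T : unbounded H.

Lemma ip_conj x y : ip x y = Num.conj (ip y x).
Proof. by rewrite hermC expr0 mul1r. Qed.

Lemma cauchy_schwarz x y : `|ip x y| <= `|x| * `|y|.
Proof.
have [->|y0] := eqVneq y 0; first by rewrite linear0r !normr0 mulr0.
have ny : 0 < `|y| ^+ 2 by rewrite exprn_gt0 // normr_gt0.
rewrite -(@ler_pXn2r _ 2) ?nnegrE ?mulr_ge0 // exprMn.
(* [c *: y] is the orthogonal projection of [x] on the line of [y] *)
pose c := ip x y / `|y| ^+ 2.
have : 0 <= `|x - c *: y| ^+ 2 by rewrite exprn_ge0.
rewrite hH linearBl /= !linearBr /= !linearZl_LR /= !linearZr_LR /= -!hH.
have cy : Num.conj (`|y| ^+ 2) = `|y| ^+ 2.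
  by rewrite rmorphXn /= conj_Creal // normr_real.
rewrite (ip_conj y x) /c rmorphM fmorphV /= cy.
rewrite divfK ?gt_eqF // subrr subr0.
by rewrite mulrAC [_ * ip x y]mulrC -normCK subr_ge0 ler_pdivrMr.
Qed.

Lemma normIm_le (p : R[i]) : `|'Im p| <= `|p|.
Proof.
rewrite -(@ler_pXn2r _ 2) ?nnegrE // real_normK ?Creal_Im //.
by rewrite normC2_Re_Im lerDr real_exprn_even_ge0 // Creal_Re.
Qed.

(** As [<T x, x>] is real, [<(T - w) x, x>] has imaginary part
    [- Im w |x|^2]. *)
Lemma symmetric_lower_bound T (w : R[i]) x : symmetric_operator ip T ->
  udom T x -> `|'Im w| * `|x| <= `|T x - w *: x|.
Proof.
move=> symT dx; have [->|x0] := eqVneq x 0; first by rewrite normr0 mulr0.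
have nx : 0 < `|x| by rewrite normr_gt0.
rewrite -(ler_pM2r nx) (le_trans _ (cauchy_schwarz _ _)) //.
rewrite linearBl /= linearZl_LR /= -hH.
have real : ip (T x) x \is Num.real.
  by rewrite CrealE -ip_conj -(symT x x) // eqxx.
have -> : `|'Im w| * `|x| * `|x| = `|'Im (ip (T x) x - w * `|x| ^+ 2)|.
  rewrite raddfB /= (Creal_ImP _ real) sub0r normrN.
  by rewrite ImMr ?rpredX ?normr_real // normrM normrX normr_id mulrA.
exact: normIm_le.
Qed.

Lemma symmetric_resolvent_bound T (w : R[i]) G y : symmetric_operator ip T ->
  is_resolvent T w G -> 0 < `|'Im w| -> `|G y| <= `|'Im w|^-1 * `|y|.
Proof.
move=> symT [GR _] w0; have [dy ey] := GR y.
rewrite mulrC ler_pdivlMr // mulrC.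
by have := symmetric_lower_bound w symT dy; rewrite ey.
Qed.

(** Leaving the starting point [z] along the imaginary axis, on the side [s] on
    which [z] lies, a first step [t] is admissible because a compact resolvent
    is bounded.  From then on [|Im w| >= t], so that [1 / t] bounds every
    resolvent on the way and steps of the fixed length [t / 2] are
    admissible. *)
Lemma compact_resolvent_far T (M : R[i]) : 0 <= M ->
  linear_operator T -> symmetric_operator ip T -> compact_resolvent T ->
  exists w G, [/\ compact_resolvent_at T w G, 0 < `|'Im w| & M <= `|'Im w|].
Proof.
move=> M0 linT symT [z [G0 [rG0 cG0]]].
have [K K0 G0K] := compact_operator_bounded cG0.
have [s [sreal s1 sz]] :
    exists s : R[i], [/\ s \is Num.real, `|s| = 1 & 0 <= s * 'Im z].
  have /orP[z0|z0] := Creal_Im z.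
    by exists 1; rewrite normr1 mul1r rpred1.
  by exists (-1); rewrite normrN1 mulN1r oppr_ge0 rpredN1.
have ss : s * s = 1 by rewrite -expr2 -real_normK // s1 expr1n.
have sIm (w d : R[i]) :
    d \is Num.real -> s * 'Im (w + s * d * 'i) = s * 'Im w + d.
  move=> dr; rewrite raddfD /= ImMir (Creal_ReP _ _) ?rpredM // mulrDr.
  by rewrite mulrA ss mul1r.
have sIm_le (w : R[i]) : s * 'Im w <= `|'Im w|.
  rewrite -['Im w in leRHS]mul1r -ss -mulrA normrM s1 mul1r real_ler_norm //.
  by rewrite rpredM // Creal_Im.
have sd (d : R[i]) : 0 <= d -> `|s * d * 'i| = d.
  by move=> d0; rewrite !normrM normCi s1 mul1r mulr1 ger0_norm.
have K1 : 0 < K + 1 by rewrite ltr_wpDl.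
pose t : R[i] := 2^-1 / (K + 1).
have t0 : 0 < t by rewrite divr_gt0 // invr_gt0.
have treal : t \is Num.real by rewrite gtr0_real.
have t2 : 0 < 2^-1 * t by rewrite mulr_gt0 ?invr_gt0.
have walk n : exists w G, compact_resolvent_at T w G /\
    t + n%:R * (2^-1 * t) <= s * 'Im w.
  elim: n => [|n [w [G [rG hw]]]].
    have [|G hG] := @compact_resolvent_shift _ _ T z (s * t * 'i) G0 K
      linT (conj rG0 cG0) G0K.
      rewrite (sd _ (ltW t0)) /t mulrAC ler_pdivrMr //.
      by rewrite ler_pM2l ?invr_gt0 // lerDl.
    by exists (z + s * t * 'i), G; rewrite sIm // mul0r addr0 lerDr.
  have tw : t <= `|'Im w|.
    apply: le_trans (sIm_le w); apply: le_trans hw.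
    by rewrite lerDl mulr_ge0 // ltW.
  have w0 := lt_le_trans t0 tw.
  have [|G' hG'] := compact_resolvent_shift (d := s * (2^-1 * t) * 'i) linT rG
    (fun y => symmetric_resolvent_bound y symT rG.1 w0).
    by rewrite (sd _ (ltW t2)) ler_pdivrMr // ler_pM2l ?invr_gt0.
  exists (w + s * (2^-1 * t) * 'i), G'; split => //.
  rewrite sIm; last by rewrite gtr0_real.
  by rewrite -[n.+1]addn1 natrD mulrDl mul1r addrA lerD2r.
have [n hn] := complex_archimedean (divr_ge0 M0 (ltW t2)).
have [w [G [rG hw]]] := walk n; exists w, G.
have {}hw := le_trans hw (sIm_le w).
split => //.
  by apply: lt_le_trans hw; rewrite ltr_wpDr // mulr_ge0 // ltW.
apply: le_trans hw; rewrite (@le_trans _ _ (n%:R * (2^-1 * t))) //.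
  by rewrite -ler_pdivrMr // ltW.
by rewrite lerDr ltW.
Qed.

Lemma compact_resolvent_bounded_perturbation T T' (V : H -> H) (M : R[i]) :
  linear_operator T -> symmetric_operator ip T -> compact_resolvent T ->
  linear_operator (Unbounded (udom T) V) -> 0 <= M ->
  (forall x, udom T x -> `|V x| <= M * `|x|) ->
  linear_operator T' -> udom T' = udom T ->
  (forall x, udom T x -> T' x = T x + V x) -> compact_resolvent T'.
Proof.
move=> linT symT crT linV M0 hV linT' dT' hT'.
have [w [G [rG w0 hw]]] :=
  compact_resolvent_far (mulr_ge0 (ler0n _ 2) M0) linT symT crT.
have [||G' [rG' cG']] := compact_resolvent_perturbation (z' := w) linT linV rG
  hV (fun y => symmetric_resolvent_bound y symT rG.1 w0) M0 _ linT' dT'.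
- by rewrite ler_pdivrMr // mulrC ler_pdivlMr // mulrC.
- by move=> x dx; rewrite hT' // addrAC.
by exists w, G'.
Qed.

Lemma dense_approx (E : set H) (y : H) (e : R[i]) :
  dense E -> 0 < e -> exists2 x, E x & `|y - x| < e.
Proof.
move=> dE e0.
have [x [/interior_subset + Ex]] : (ball y e)^° `&` E !=set0.
  apply: dE; last exact: open_interior.
  by exists y; rewrite /interior; exact: nbhsx_ballx.
by rewrite -ball_normE => yx; exists x.
Qed.

(** The vector [v] is the value at [y] of the continuous extension of [V]. *)
Lemma bounded_symmetric_weak_adjoint (E : set H) (V : H -> H) (M : R[i]) :
  dense E -> linear_operator (Unbounded E V) -> 0 <= M ->
  (forall x, E x -> `|V x| <= M * `|x|) ->
  (forall x y, E x -> E y -> ip (V x) y = ip x (V y)) ->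
  forall y, exists v, forall x, E x -> ip (V x) y = ip x v.
Proof.
move=> dE linV M0 hV symV y.
have half0 n : 0 < (2^-1 ^+ n : R[i]) by rewrite exprn_gt0 // invr_gt0.
have approx n : exists x, E x /\ `|y - x| < 2^-1 ^+ n.
  by have [x] := dense_approx y dE (half0 n); exists x.
have [s hs] := choice approx.
have [v sv] : exists v : H, (V \o s) @ \oo --> v.
  exists (lim ((V \o s) @ \oo)).
  apply: (@half_steps_cvg _ _ _ (M * 2)) => n /=.
  have [[Es ys] [Es' ys']] := (hs n, hs n.+1).
  rewrite -(uappB linV) // -mulrA (le_trans (hV _ (udomB linV Es' Es))) //.
  rewrite ler_wpM2l // -(subrKA y) (le_trans (ler_normD _ _)) //.
  rewrite mulr_natl mulr2n lerD ?(ltW ys) // distrC (le_trans (ltW ys')) //.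
  by rewrite exprS ger_pMl // invf_le1 // ler1n.
exists v => x Ex; apply/subr0_eq.
apply/(@eq0_of_le_small _ _ _ (`|V x| + `|x|)) => [|e e0].
  by rewrite addr_ge0.
have [k hk] := half_pow_lt ler01 e0.
move/cvgrPdist_lt: sv => /(_ _ e0) [n _ hn].
pose j := maxn n k.
have [Ej yj] := hs j.
have -> : ip (V x) y - ip x v = ip (V x) (y - s j) - ip x (v - V (s j)).
  by rewrite !linearBr /= (symV x (s j)) // opprB addrA subrK.
rewrite (le_trans (ler_normB _ _)) // mulrDl lerD //.
  rewrite (le_trans (cauchy_schwarz _ _)) // ler_wpM2l //.
  rewrite (le_trans (ltW yj)) // ltW // (le_lt_trans _ hk) // mul1r.
  by rewrite ler_wiXn2l ?invr_ge0 ?invf_le1 ?ler1n // leq_maxr.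
rewrite (le_trans (cauchy_schwarz _ _)) // ler_wpM2l //.
by rewrite ltW // hn //= leq_maxl.
Qed.

Lemma selfadjoint_bounded_perturbation T T' (V : H -> H) (M : R[i]) :
  selfadjoint ip T -> linear_operator (Unbounded (udom T) V) -> 0 <= M ->
  (forall x, udom T x -> `|V x| <= M * `|x|) ->
  (forall x y, udom T x -> udom T y -> ip (V x) y = ip x (V y)) ->
  udom T' = udom T -> (forall x, udom T x -> T' x = T x + V x) ->
  selfadjoint ip T'.
Proof.
move=> [dT saT] linV M0 hV symV dT' hT'.
split=> [|y z]; first by rewrite /densely_defined dT'.
have [v hv] := bounded_symmetric_weak_adjoint dT linV M0 hV symV y.
have adjE z' : adjoint_graph ip T' y z' <-> adjoint_graph ip T y (z' - v).
  split=> h x; rewrite ?dT' => dx.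
    by rewrite linearBr /= -hv // -h ?dT' // hT' // linearDl addrK.
  by rewrite hT' // linearDl /= h // hv // -linearDr /= subrK.
(* on the domain both [v] and [V y] yield the value of the adjoint at [y] *)
have vE : udom T y -> v = V y.
  move=> dy; have /adjE h : adjoint_graph ip T' y (T y + V y).
    move=> x; rewrite dT' => dx; rewrite hT' // linearDl linearDr /= symV //.
    by congr (_ + _); apply: (iffRL (saT y (T y))).
  have [_] := (saT _ _).1 h.
  by move=> /esym/eqP; rewrite subr_eq => /eqP/addrI ->.
rewrite adjE saT dT'; split=> [[dy e]|[dy <-]]; split=> //.
  by rewrite hT' // -vE // e subrK.
by rewrite hT' // vE // addrK.
Qed.

(** Bounded commutators are preserved since [[V, c]] is itself bounded. *)
Lemma spectral_triple_perturbation (A : set (H -> H)) T T' (V : H -> H)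
    (M : R[i]) :
  spectral_triple ip A T ->
  linear_operator (Unbounded (udom T) V) -> 0 <= M ->
  (forall x, udom T x -> `|V x| <= M * `|x|) ->
  (forall x y, udom T x -> udom T y -> ip (V x) y = ip x (V y)) ->
  udom T' = udom T -> (forall x, udom T x -> T' x = T x + V x) ->
  spectral_triple ip A T'.
Proof.
move=> hS linV M0 hV symV dT' hT'; have linT := st_linear hS.
have linT' : linear_operator T'.
  split=> [|c x y]; rewrite dT'; first exact: udom0.
  move=> dx dy; have [dxy Txy] := linT.2 c _ _ dx dy.
  have [_ /= Vxy] := linV.2 c _ _ dx dy.
  by split=> //; rewrite !hT' // Txy Vxy scalerDr addrACA.
have symT : symmetric_operator ip T.
  by move=> x y dx dy; apply: (iffRL ((st_selfadjoint hS).2 y (T y))).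
split.
- exact: st_algebra hS.
- exact: linT'.
- exact: selfadjoint_bounded_perturbation (st_selfadjoint hS) linV M0 hV symV
    dT' hT'.
- exact: compact_resolvent_bounded_perturbation linT symT (st_compact hS) linV
    M0 hV linT' dT' hT'.
- by move=> c Ac x; rewrite dT'; exact: (st_domain hS).
move=> c Ac; have [Mc hMc] := st_bounded hS Ac.
have [linc bc] := star_bounded (st_algebra hS) Ac.
have [K K0 hK] := ubounded_ge0 bc.
exists (Mc + (M * K + K * M)) => x [_ [+ _]].
rewrite dT' => dx; have dcx : udom T (c x) := st_domain hS Ac dx.
rewrite -[X in `|X|]/(T' (c x) - c (T' x)) !hT' // (linfunD linc).
rewrite opprD addrACA mulrDl (le_trans (ler_normD _ _)) // lerD //.
  by apply: hMc; split; split.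
rewrite mulrDl (le_trans (ler_normB _ _)) // lerD //.
  by rewrite (le_trans (hV _ dcx)) // -mulrA ler_wpM2l // hK.
by rewrite (le_trans (hK _ I)) // -mulrA ler_wpM2l // hV.
Qed.

End HilbertSpace.

(** * Real structures *)

Section RealStructure.
Context {R : realType} {H : completeNormedModType R[i]}.
Variables (J Jinv : H -> H).
Hypotheses (isoJ : antilinear_isometry J).
Hypotheses (JK : cancel J Jinv) (JinvK : cancel Jinv J).
Hypothesis J2 : (forall x, J (J x) = x) \/ (forall x, J (J x) = - x).

Lemma antilinearD x y : J (x + y) = J x + J y.
Proof. by have := isoJ.1 1 x y; rewrite rmorph1 !scale1r. Qed.

Lemma antilinear0 : J 0 = 0.
Proof. by have := antilinearD 0 0; rewrite addr0 -{1}[J 0]addr0 => /addrI. Qed.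

Lemma antilinearZ (c : R[i]) x : J (c *: x) = Num.conj c *: J x.
Proof. by rewrite -[c *: x]addr0 isoJ.1 antilinear0 addr0. Qed.

Lemma inverse_antilinear (c : R[i]) x y :
  Jinv (c *: x + y) = Num.conj c *: Jinv x + Jinv y.
Proof. by apply: (can_inj JK); rewrite isoJ.1 !JinvK conjCK. Qed.

(** Carrying the sign [J^2 = s] as a real scalar treats both cases at once: it
    passes through linear and antilinear maps alike, and squares to one. *)
Lemma real_structure_sign : exists s : R[i], [/\ s * s = 1,
  (forall x, J (J x) = s *: x) & forall x, Jinv x = s *: J x].
Proof.
suff [s [cs ss JJ]] : exists s : R[i], [/\ Num.conj s = s, s * s = 1 &
    forall x, J (J x) = s *: x].
  exists s; split => // x; apply: (can_inj JK).
  by rewrite JinvK antilinearZ cs JJ scalerA ss scale1r.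
case: J2 => h; [exists 1|exists (-1)]; split.
- by rewrite rmorph1.
- by rewrite mulr1.
- by move=> x; rewrite scale1r.
- by rewrite rmorphN1.
- by rewrite mulrNN mulr1.
- by move=> x; rewrite scaleN1r.
Qed.

End RealStructure.

(** * Fluctuations of a multitwisted real structure *)

Section Fluctuations.
Context {R : realType} {H : completeNormedModType R[i]}.
Variables (ip : {dot H for (@Num.conj R[i])}).
Variables (A : set (H -> H)) (D : unbounded H) (J Jinv : H -> H).
Variables (N : nat) (Dl : 'I_N -> unbounded H) (nu nuinv : 'I_N -> H -> H).
Hypothesis hD : multitwisted_real_structure ip A J Jinv nu nuinv D Dl.
Hypothesis hfirst : first_order A J Jinv nu nuinv Dl.
Variables (e : R[i]) (he : e = 1 \/ e = -1).
Hypothesis heps : epsilon'_condition J nu e Dl.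
Variables (m : nat) (a b : 'I_m -> H -> H).
Hypotheses (ha : forall i, A (a i)) (hb : forall i, A (b i)).

Notation E l := (udom (Dl l)).
Notation hat l c := (conjugate_by J Jinv (conjugate_by (nu l) (nuinv l) c)).
Notation chk l c := (conjugate_by J Jinv (conjugate_by (nuinv l) (nu l) c)).
Notation om l := (one_form a b (Dl l)).
Notation W l := (twisted_conjugate J Jinv nu a b Dl l).
Notation Dl' := (real_fluctuation J Jinv nu a b e Dl).
Notation D' := (fluctuated_D J Jinv nu a b e D Dl).

Let hR := mt_triple hD.
Let hS := rst_triple hR.
Let JK : cancel J Jinv := (rst_inv hR).1.
Let JinvK : cancel Jinv J := (rst_inv hR).2.
Let isoJ := rst_isometry hR.
Let J2 := rst_square hR.
Let nuK l : cancel (nu l) (nuinv l).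
Proof. by case: (mt_twist_inv hD l). Qed.
Let nuinvK l : cancel (nuinv l) (nu l).
Proof. by case: (mt_twist_inv hD l). Qed.
Let linnu l : linear (nu l) := (mt_twist hD l).1.
Let linnuinv l : linear (nuinv l).
Proof. by case: (mt_twist_inv hD l) => -[]. Qed.

Lemma algebra_linear c : A c -> linear c.
Proof. by move=> /(star_bounded (st_algebra hS)) []. Qed.

Lemma epsilon_sign : [/\ Num.conj e = e, e * e = 1 & `|e| = 1].
Proof.
by case: he => ->; rewrite ?rmorph1 ?rmorphN1 ?normrN1 ?normr1 ?mulrNN mulr1.
Qed.

(** The epsilon condition equates two operators, hence also their natural
    domains. *)
Lemma twist_domain l x : E l (J (nu l x)) <-> E l x.
Proof.
have [h _] := heps l.
have hx := congr1 (fun S : set H => S x) h; rewrite /= in hx.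
split=> hE.
  have : ((True /\ True) /\ E l (J (nu l x))) by [].
  by rewrite hx => -[[]].
have : ((E l x /\ True) /\ True) by [].
by rewrite -hx => -[].
Qed.

Lemma twist_domain_inv l x : E l x -> E l (Jinv (nu l x)).
Proof.
move=> /twist_domain dx.
have [s [_ _ ->]] := real_structure_sign isoJ JK JinvK J2.
exact: (udomZ (mt_linear hD l)).
Qed.

Lemma conjugate_domain l c x : A c -> E l x -> E l (hat l c x).
Proof.
move=> Ac dx; apply/twist_domain; apply: (mt_domain hD) => //.
by apply/twist_domain; rewrite nuinvK JinvK.
Qed.

Lemma conjugate_linear (f finv c : H -> H) :
  linear f -> linear finv -> A c ->
  linear (conjugate_by J Jinv (conjugate_by f finv c)).
Proof.
move=> linf linfinv Ac k x y; rewrite /conjugate_by /=.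
rewrite (inverse_antilinear isoJ JK JinvK) linfinv (algebra_linear Ac) linf.
by rewrite isoJ.1 conjCK.
Qed.

Lemma commutator_domain l c x : A c -> udom (ucomm (Dl l) c) x <-> E l x.
Proof.
move=> Ac; split=> [[_ [? _]] //|dx]; split; split=> //.
exact: (mt_domain hD).
Qed.

Lemma first_order_at l c d x : A c -> A d -> E l x ->
  chk l c (Dl l (d x) - d (Dl l x)) =
  Dl l (d (hat l c x)) - d (Dl l (hat l c x)).
Proof.
move=> Ac Ad dx; have [_] := hfirst l Ad Ac; apply; split => //.
exact/commutator_domain.
Qed.

Lemma one_form_domain l x : E l x -> udom (om l) x.
Proof. by move=> dx i; split => //; exact/commutator_domain. Qed.

Lemma one_formE l x :
  om l x = \sum_(i < m) a i (Dl l (b i x) - b i (Dl l x)).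
Proof. by []. Qed.

Lemma one_form_linear l : linear_operator (Unbounded (E l) (om l)).
Proof.
have [d0 linD] := mt_linear hD l; split=> // c x y /= dx dy.
have [dxy Dxy] := linD c _ _ dx dy; split=> //.
rewrite -![\sum_(i < m) _]/(om l _) !one_formE scaler_sumr -big_split /=.
apply: eq_bigr => i _.
have linb := algebra_linear (hb i).
have dbx := mt_domain hD (hb i) dx; have dby := mt_domain hD (hb i) dy.
rewrite linb (linD c _ _ dbx dby).2 Dxy linb opprD addrACA -scalerBr.
exact: algebra_linear.
Qed.

(** Each term [a_i [D_l, b_i]] intertwines [hat c] with [chk c]: the commutator
    by the first order condition, [a_i] because it commutes with [chk c]. *)
Lemma one_form_first_order l c y : A c -> E l y ->
  chk l c (om l y) = om l (hat l c y).
Proof.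
move=> Ac dy; have linc := conjugate_linear (linnuinv l) (linnu l) Ac.
rewrite !one_formE (linfun_sum linc); apply: eq_bigr => i _.
rewrite -first_order_at //.
have [_] := mt_zero_order hD l (ha i) Ac.
by move=> /(congr1 (fun f => f (Dl l (b i y) - b i (Dl l y)))) /= ->.
Qed.

Lemma twisted_conjugateE l x : W l x = nu l (J (om l (Jinv (nu l x)))).
Proof. by []. Qed.

Lemma twisted_conjugate_domain l x : E l x -> udom (W l) x.
Proof.
move=> dx; have := one_form_domain (twist_domain_inv dx).
by move=> ?; split=> //; split=> //; split.
Qed.

Lemma twisted_conjugate_linear l (c : R[i]) x y : E l x -> E l y ->
  W l (c *: x + y) = c *: W l x + W l y.
Proof.
move=> /twist_domain_inv dx /twist_domain_inv dy.
rewrite !twisted_conjugateE linnu (inverse_antilinear isoJ JK JinvK).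
have [_ ->] := (one_form_linear l).2 (Num.conj c) _ _ dx dy.
by rewrite isoJ.1 conjCK linnu.
Qed.

(** Moving [c] to the left through [nu J om J^-1 nu] turns it into [hat c] to
    the right of [om], into [chk c] to its left, and back into [c]; the two
    signs of [J^-1 = s J] cancel. *)
Lemma twisted_conjugate_commutes l c x :
  A c -> E l x -> W l (c x) = c (W l x).
Proof.
move=> Ac dx; have [s [ss JJ JinvE]] := real_structure_sign isoJ JK JinvK J2.
have dJ := twist_domain_inv dx.
have linc := algebra_linear Ac.
have linh := conjugate_linear (linnu l) (linnuinv l) Ac.
have e1 : Jinv (nu l (c x)) = hat l c (Jinv (nu l x)).
  by rewrite [in RHS]JinvE (linfunZ linh) JinvE /conjugate_by /= JK nuK.
rewrite !twisted_conjugateE e1 -one_form_first_order // /conjugate_by /=.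
rewrite JJ JinvE !(linfunZ (linnu l)) (linfunZ linc) (linfunZ (linnuinv l)).
by rewrite (linfunZ (linnu l)) scalerA ss scale1r nuinvK.
Qed.

Lemma real_fluctuationE l x : Dl' l x = Dl l x + om l x + e *: W l x.
Proof. by []. Qed.

Lemma real_fluctuation_domain l : udom (Dl' l) = E l.
Proof.
apply/seteqP; split=> [x [[dx _] _] //|x dx]; split.
  by split => //; exact: one_form_domain.
exact: twisted_conjugate_domain.
Qed.

Lemma fluctuation_domain l : udom (fluctuation a b Dl l) = E l.
Proof.
apply/seteqP; split=> [x []//|x dx]; split=> //.
exact: one_form_domain.
Qed.

Lemma real_fluctuation_linear l : linear_operator (Dl' l).
Proof.
have [d0 linD] := mt_linear hD l.
split=> [|c x y]; rewrite !real_fluctuation_domain // => dx dy.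
have [dxy Dxy] := linD c x y dx dy; split => //.
have [_ omxy] := (one_form_linear l).2 c x y dx dy.
rewrite !real_fluctuationE Dxy twisted_conjugate_linear //.
rewrite -[om l _]/((Unbounded (E l) (om l)) (c *: x + y)) omxy.
rewrite !scalerDr !scalerA [e * c]mulrC [RHS]addrACA; congr (_ + _).
exact: addrACA.
Qed.

Lemma real_fluctuation_stable l : stabilizes_domain A (Dl' l).
Proof.
by move=> c Ac x; rewrite real_fluctuation_domain; exact: (mt_domain hD).
Qed.

Lemma real_fluctuation_commutator l c x : A c -> E l x ->
  Dl' l (c x) - c (Dl' l x) =
  Dl l (c x) - c (Dl l x) + (om l (c x) - c (om l x)).
Proof.
move=> Ac dx; have linc := algebra_linear Ac.
rewrite !real_fluctuationE !(linfunD linc) (linfunZ linc).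
rewrite twisted_conjugate_commutes // opprD addrACA subrr addr0.
by rewrite opprD addrACA.
Qed.

Lemma real_fluctuation_ucomm l c : A c ->
  ueq (ucomm (Dl' l) c) (ucomm (fluctuation a b Dl l) c).
Proof.
move=> Ac; split.
  by apply: ucomm_domain; rewrite real_fluctuation_domain fluctuation_domain.
move=> x [_ [+ _]]; rewrite real_fluctuation_domain => dx.
rewrite -[LHS]/(Dl' l (c x) - c (Dl' l x)) real_fluctuation_commutator //.
rewrite -[RHS]/(Dl l (c x) + om l (c x) - c (Dl l x + om l x)).
by rewrite (linfunD (algebra_linear Ac)) opprD addrACA.
Qed.

Lemma real_fluctuation_first_order : first_order A J Jinv nu nuinv Dl'.
Proof.
move=> l d c Ad Ac.
have linc := conjugate_linear (linnuinv l) (linnu l) Ac.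
have cdom x : udom (ucomm (Dl' l) d) x <-> E l x.
  rewrite -(commutator_domain l x Ad).
  by rewrite (ucomm_domain _ (real_fluctuation_domain l)).
split=> [x [/cdom dx _]|x [/cdom dx _]].
  by split=> //; apply/cdom/conjugate_domain.
have dhx := conjugate_domain Ac dx.
have ddx := mt_domain hD Ad dx.
have [dhat dchk] := mt_zero_order hD l Ad Ac.
have {}dhat : hat l c (d x) = d (hat l c x).
  by move: dhat => /(congr1 (fun f => f x)) /= ->.
have {}dchk : chk l c (d (om l x)) = d (chk l c (om l x)).
  by move: dchk => /(congr1 (fun f => f (om l x))) /= ->.
rewrite [LHS](congr1 (chk l c) (real_fluctuation_commutator Ad dx)).
rewrite [RHS](real_fluctuation_commutator Ad dhx).
rewrite (linfunD linc) (first_order_at Ac Ad dx) (linfunB linc) dchk.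
by rewrite !one_form_first_order // dhat.
Qed.

Lemma real_fluctuation_epsilon :
  regular_twists J nu -> epsilon'_condition J nu e Dl'.
Proof.
move=> hreg l.
have dom' x : udom (Dl' l) (J (nu l x)) <-> udom (Dl' l) x.
  by rewrite !real_fluctuation_domain; exact: twist_domain.
split=> [|x [_ /dom']].
  apply/seteqP; split=> x [dx dx']; first by split=> //; split=> //; exact/dom'.
  by split=> //; apply/dom'; case: dx.
rewrite real_fluctuation_domain => dx.
have [ce ee _] := epsilon_sign.
have [s [ss JJ JinvE]] := real_structure_sign isoJ JK JinvK J2.
have dJ := (twist_domain l x).2 dx.
have h : Dl l (J (nu l x)) = e *: nu l (J (Dl l x)).
  by have [_ /(_ x)] := heps l; apply.
have WJ : W l (J (nu l x)) = nu l (J (om l x)).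
  by rewrite twisted_conjugateE hreg JK.
have JW : nu l (J (W l x)) = om l (J (nu l x)).
  have omZ := uappZ (one_form_linear l) s dJ; rewrite /= in omZ.
  rewrite twisted_conjugateE hreg JJ JinvE.
  by rewrite [om l _]omZ scalerA ss scale1r.
rewrite -[LHS]/(Dl' l (J (nu l x))) -[RHS]/(e *: nu l (J (Dl' l x))).
rewrite !real_fluctuationE.
rewrite !(antilinearD isoJ) (antilinearZ isoJ) ce !(linfunD (linnu l)).
rewrite (linfunZ (linnu l)) h WJ JW !scalerDr scalerA ee scale1r.
by rewrite addrAC.
Qed.

Lemma fluctuated_D_domain : udom D' = udom D.
Proof.
apply/seteqP; split=> [x []//|x dx]; split=> // l.
rewrite -[udom _]/(udom (Dl' l)) real_fluctuation_domain.
exact: (mt_contains hD).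
Qed.

(** On the domain of [D] the parts [om l] sum up to the one-form of [D], a
    bounded symmetric operator, and the parts [W l] have by assumption a
    bounded symmetric sum. *)
Lemma fluctuated_D_perturbation :
  bounded_selfadjoint ip (one_form a b D) ->
  ubounded (usum (twisted_conjugate J Jinv nu a b Dl)) ->
  symmetric_operator ip (usum (twisted_conjugate J Jinv nu a b Dl)) ->
  exists (V : H -> H) (M : R[i]),
    [/\ linear_operator (Unbounded (udom D) V), 0 <= M,
        forall x, udom D x -> `|V x| <= M * `|x|,
        forall x y, udom D x -> udom D y -> ip (V x) y = ip x (V y)
      & forall x, udom D x -> D' x = D x + V x].
Proof.
move=> [B [[linB bB] [_ saB] [_ BE]]] bW symW.
set Ws := usum _ in bW symW.
have dDl l x : udom D x -> E l x by exact: (mt_contains hD).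
have DE x : udom D x -> D x = \sum_(l < N) Dl l x.
  by move=> dx; have [_ ->] := mt_sum hD.
have domW x : udom D x -> udom Ws x.
  by move=> dx l; apply/twisted_conjugate_domain/dDl.
have symB x y : ip (B x) y = ip x (B y) by apply: (iffRL (saB y (B y))).
have domDb i x : udom D x -> udom D (b i x) := st_domain hS (hb i) (x := x).
have BEsum x : udom D x -> B x = \sum_(l < N) om l x.
  move=> dx; rewrite -[LHS](BE x) /=; last first.
    by move=> i; do ! split=> //; exact: domDb.
  rewrite exchange_big /=; apply: eq_bigr => i _.
  rewrite -(linfun_sum (algebra_linear (ha i))) sumrB.
  by rewrite -(linfun_sum (algebra_linear (hb i))) -!DE //; exact: domDb.
have linW (c : R[i]) x y : udom D x -> udom D y ->
    Ws (c *: x + y) = c *: Ws x + Ws y.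
  move=> dx dy; rewrite /= scaler_sumr -big_split /=; apply: eq_bigr => l _.
  by apply: twisted_conjugate_linear; exact: dDl.
have [MB MB0 hMB] := ubounded_ge0 bB.
have [MW MW0 hMW] := ubounded_ge0 bW.
have [ce ee ne] := epsilon_sign.
exists (fun x => B x + e *: Ws x), (MB + MW); split.
- split=> [|c x y /= dx dy]; first exact: (st_linear hS).1.
  split; first exact: ((st_linear hS).2 c _ _ dx dy).1.
  rewrite linB -![\sum_(i < N) _]/(Ws _) linW //.
  by rewrite !scalerDr addrACA !scalerA [e * c]mulrC.
- by rewrite addr_ge0.
- move=> x dx; rewrite mulrDl (le_trans (ler_normD _ _)) // lerD //.
    exact: hMB.
  by rewrite normrZ ne mul1r hMW //; exact: domW.
- move=> x y dx dy.
  rewrite linearDl /= linearDr /= symB linearZl_LR linearZr_LR /= ce.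
  by rewrite -![\sum_(i < N) _]/(Ws _) (symW x y) //; exact: domW.
move=> x dx; rewrite DE // BEsum // scaler_sumr addrA -!big_split /=.
by apply: eq_bigr.
Qed.

End Fluctuations.

Unset Implicit Arguments.

Theorem proposition2p8 (R : realType) (H : completeNormedModType R[i])
  (ip : {dot H for (@Num.conj R[i])}) (hH : hilbert_norm ip)
  (A : set (H -> H)) (D : unbounded H) (J Jinv : H -> H)
  (N : nat) (Dl : 'I_N -> unbounded H) (nu nuinv : 'I_N -> H -> H)
  (hD : multitwisted_real_structure ip A J Jinv nu nuinv D Dl)
  (hfirst : first_order A J Jinv nu nuinv Dl)
  (e : R[i]) (he : e = 1 \/ e = -1)
  (heps : epsilon'_condition J nu e Dl)
  (hreg : regular_twists J nu)
  (m : nat) (a b : 'I_m -> H -> H)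
  (ha : forall i, A (a i)) (hb : forall i, A (b i))
  (homega : bounded_selfadjoint ip (one_form a b D))
  (hbounded : ubounded (usum (twisted_conjugate J Jinv nu a b Dl)))
  (hsymmetric : symmetric_operator ip (usum (twisted_conjugate J Jinv nu a b Dl))) :
  let Dl' := real_fluctuation J Jinv nu a b e Dl in
  let D' := fluctuated_D J Jinv nu a b e D Dl in
  [/\ multitwisted_real_structure ip A J Jinv nu nuinv D' Dl',
      first_order A J Jinv nu nuinv Dl',
      epsilon'_condition J nu e Dl'
    & forall (l : 'I_N) (c : H -> H), A c ->
        ueq (ucomm (Dl' l) c) (ucomm (fluctuation a b Dl l) c)].
Proof.
move=> Dl' D'.
have dom' l : udom (Dl' l) = udom (Dl l) :=
  real_fluctuation_domain hD heps a hb l.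
have domD' : udom D' = udom D := fluctuated_D_domain hD heps a hb.
have [V [M [linV M0 Vb symV D'E]]] :=
  fluctuated_D_perturbation hD he heps ha hb homega hbounded hsymmetric.
have [hS isoJ invJ sqJ commJ] := mt_triple hD.
split; last 1 first.
  move=> l c Ac; exact (real_fluctuation_ucomm hD hfirst heps ha hb l Ac).
- split.
  + split=> //.
    exact (spectral_triple_perturbation hH hS linV M0 Vb symV domD' D'E).
  + exact (real_fluctuation_linear hD heps ha hb).
  + by move=> l; rewrite /densely_defined dom'; exact: (mt_dense hD).
  + by move=> l; rewrite domD' dom'; exact: (mt_contains hD).
  + exact (real_fluctuation_stable hD heps hb).
  + split=> [|x //]; apply/seteqP; split=> [x dx|x [dx _] //]; split=> //.
    by case: dx.
  + exact: (mt_twist hD).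
  + exact: (mt_twist_inv hD).
  + exact: (mt_zero_order hD).
- exact (real_fluctuation_first_order hD hfirst heps ha hb).
- exact (real_fluctuation_epsilon hD he heps ha hb hreg).
Qed.
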